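(* Suppose $X$ is a complete metric space which has Nagata dimension zero with constant $c$. Then there exists an $8c$-bilipschitz embedding $f\colon X\to Y$ into a complete $\mathbb{R}$-tree $Y$ such that $\operatorname{sing} Y\subset f(X)$.
   Context: A metric space $X$ has \emph{Nagata dimension zero with constant} $c$ if for all real numbers $s>0$, $X$ admits a covering $\mathcal{B}_s$ (by subsets of $X$) with $\operatorname{diam}(B)\leq cs$ for every $B\in\mathcal{B}_s$ and $d(B,B')>s$ for all distinct $B,B'\in\mathcal{B}_s$, where $d(B,B')=\inf\{d(b,b'): b\in B,\ b'\in B'\}$. A map $f\colon X\to Y$ between metric spaces is $C$-\emph{bilipschitz}, for a constant $C\geq 0$, if there exists $s>0$ such that $s\,d(x,y)\leq d(f(x),f(y))\leq Cs\,d(x,y)$ for all $x,y\in X$. An $\mathbb{R}$-\emph{tree} is a uniquely geodesic metric space $Y$ such that whenever $[y_1,y_2]\cap[y_2,y_3]=\{y_2\}$ one has $[y_1,y_2]\cup[y_2,y_3]=[y_1,y_3]$, for all $y_1,y_2,y_3\in Y$; here $[y_i,y_j]$ denotes the unique geodesic in $Y$ connecting $y_i$ to $y_j$. A point $y\in Y$ is \emph{regular} if there exists an isometric embedding $U(y,\varepsilon)\to\mathbb{R}$ for some $\varepsilon>0$, where $U(y,\varepsilon)$ is the open ball of radius $\varepsilon$ centered at $y$. Every point which is not regular is \emph{singular}, and $\operatorname{sing}Y$ denotes the set of singular points of $Y$. *)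

(* Defs.v *)
From HB Require Import structures.
From mathcomp Require Import all_boot all_order all_algebra.
From mathcomp Require Import all_classical all_reals all_analysis.

Set Implicit Arguments.
Unset Strict Implicit.
Unset Printing Implicit Defensive.

Import Order.TTheory GRing.Theory Num.Theory.
Local Open Scope classical_set_scope.
Local Open Scope ring_scope.

(* The completeness axiom of [completeType], as a predicate: that structure is
   pointed, which would exclude the empty metric space. *)
Definition complete_space (T : uniformType) : Prop :=
  forall F : set_system T, ProperFilter F -> cauchy F -> exists x : T, F --> x.

(* [diam set0 = -oo] and [set_dist A set0 = +oo]. *)
Definition diam (R : realType) (X : metricType R) (A : set X) : \bar R :=
  ereal_sup [set (mdist a b)%:E | a in A & b in A].

Definition set_dist (R : realType) (X : metricType R) (A B : set X) : \bar R :=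
  ereal_inf [set (mdist a b)%:E | a in A & b in B].

Definition nagata_dim_zero (R : realType) (X : metricType R) (c : R) : Prop :=
  forall s : R, 0 < s -> exists Bs : set (set X),
    [/\ \bigcup_(B in Bs) B = [set: X],
        forall B, Bs B -> (diam B <= (c * s)%:E)%E
      & forall B B', Bs B -> Bs B' -> B <> B' -> (s%:E < set_dist B B')%E].

Definition bilipschitz (R : realType) (X Y : metricType R) (C : R)
    (f : X -> Y) : Prop :=
  0 <= C /\
  exists2 s : R, 0 < s & forall x y : X,
    s * mdist x y <= mdist (f x) (f y) <= C * s * mdist x y.

(* Only the values of [g] on [0, d(y, z)] matter. *)
Definition geodesic_path (R : realType) (Y : metricType R) (y z : Y)
    (g : R -> Y) : Prop :=
  [/\ g 0 = y, g (mdist y z) = z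
    & {in `[0, mdist y z] &, forall s t, mdist (g s) (g t) = `|s - t|}].

(* A geodesic is identified with its image; the arc length parametrization from
   [y] is determined by the image. *)
Definition geodesic (R : realType) (Y : metricType R) (y z : Y) : set (set Y) :=
  [set S | exists2 g, geodesic_path y z g & S = g @` `[0, mdist y z]].

Definition uniquely_geodesic (R : realType) (Y : metricType R) : Prop :=
  forall y z : Y, exists! S : set Y, geodesic y z S.

(* [y, z]; meaningful when there is exactly one geodesic from y to z. *)
Definition geodesic_segment (R : realType) (Y : metricType R) (y z : Y)
    : set Y :=
  xget set0 (geodesic y z).

Definition R_tree (R : realType) (Y : metricType R) : Prop :=
  uniquely_geodesic Y /\
  forall y1 y2 y3 : Y,
    geodesic_segment y1 y2 `&` geodesic_segment y2 y3 = [set y2] ->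
    geodesic_segment y1 y2 `|` geodesic_segment y2 y3 = geodesic_segment y1 y3.

(* [ball y e] is the open ball, by [ballEmdist]. *)
Definition regular_point (R : realType) (Y : metricType R) (y : Y) : Prop :=
  exists2 e : R, 0 < e & exists phi : Y -> R,
    forall u v, ball y e u -> ball y e v -> `|phi u - phi v| = mdist u v.

Definition sing (R : realType) (Y : metricType R) : set Y :=
  [set y | ~ regular_point y].
Arguments sing {R} Y.

(* Main.v *)
Require Import Defs.
From HB Require Import structures.
From mathcomp Require Import all_boot all_order all_algebra.
From mathcomp Require Import all_classical all_reals all_analysis.
From mathcomp Require Import wochoice zify lra.

Set Implicit Arguments.
Unset Strict Implicit.
Unset Printing Implicit Defensive.

Import Order.TTheory GRing.Theory Num.Theory numFieldNormedType.Exports.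
Local Open Scope classical_set_scope.
Local Open Scope ring_scope.

(* Calling two points equivalent at level n when they are joined by a chain of
   steps of length at most 2^n gives nested partitions of X, and Nagata dimension
   zero bounds the diameter of the classes of level n by c 2^n. Fix a well-order
   of X and let every class be represented by its least element. Join the
   representative of each class of level n to that of the class of level n + 1
   containing it by an edge of length 2^(n+1), unless both coincide: this is a
   tree whose branch points are points of X, rooted at the least element of X.
   If n is the first level at which x and y are equivalent, then
   2^(n-1) < d(x, y) <= c 2^n, while the tree distance is at least the length 2^n
   of one edge and at most 2 (2^n + 2^(n-1) + ...) = 2^(n+2); the distortion is
   thus at most 8 c.
   To have a ray going up from every point, an infinite ray is attached at the
   root. The tree then consists of the pairs (x, t), where t is at least the
   height of x, and (x, t), (y, t) are identified once t reaches the height m(x, y)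
   at which the rays from x and y merge. It satisfies the four-point
   condition, which makes a geodesic space an R-tree, and away from the closed set
   f(X) it is locally a line. *)

(** * Four-point condition and R-trees *)

Section FourPoint.
Context {R : realType} {Y : metricType R}.
Implicit Types a b x y z w : Y.

Definition metric_interval x y : set Y :=
  [set w | mdist x w + mdist w y = mdist x y].

Definition four_point : Prop := forall x y z w : Y,
  mdist x y + mdist z w <=
    Num.max (mdist x z + mdist y w) (mdist x w + mdist y z).

Definition geodesic_space : Prop :=
  forall x y : Y, exists g : R -> Y, geodesic_path x y g.

Lemma geodesic_path_mdist x y (g : R -> Y) s : geodesic_path x y g ->
  0 <= s <= mdist x y -> mdist x (g s) = s /\ mdist (g s) y = mdist x y - s.
Proof.
move=> [g0 gd gP] /[dup] /andP[s0 sd] sI.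
have I0 : (0 : R) \in `[0, mdist x y] by rewrite in_itv /= lexx mdist_ge0.
have Id : mdist x y \in `[0, mdist x y] by rewrite in_itv /= lexx mdist_ge0.
have Is : s \in `[0, mdist x y] by rewrite in_itv.
split; first by rewrite -{1}g0 gP// sub0r normrN ger0_norm.
by rewrite -{1}gd gP// distrC ger0_norm // subr_ge0.
Qed.

Hypothesis fourY : four_point.

(** The four-point condition bounds [mdist a b + mdist x y] by the larger of two sums, and here both
    sums equal [mdist x y]. *)
Lemma metric_interval_eq x y a b : metric_interval x y a ->
  metric_interval x y b -> mdist x a = mdist x b -> a = b.
Proof.
rewrite /metric_interval /= => xay xby xab; apply: mdist_positivity.
apply/eqP; rewrite eq_le mdist_ge0 andbT.
have := fourY a b x y; rewrite ![mdist _ x]metric_sym le_max => /orP[]; lra.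
Qed.

Lemma geodesic_image x y (g : R -> Y) : geodesic_path x y g ->
  g @` `[0, mdist x y] = metric_interval x y.
Proof.
move=> gxy; apply/seteqP; split => [_ [s /= sI <-]|w /= xwy].
  rewrite in_itv /= in sI; have [e1 e2] := geodesic_path_mdist gxy sI.
  by rewrite /metric_interval /= e1 e2; lra.
have sI : 0 <= mdist x w <= mdist x y.
  by rewrite mdist_ge0 -xwy lerDl mdist_ge0.
have [e1 e2] := geodesic_path_mdist gxy sI.
exists (mdist x w); first by rewrite /= in_itv.
by apply: (@metric_interval_eq x y) => //; rewrite /metric_interval /= e1 e2; lra.
Qed.

Hypothesis geodY : geodesic_space.

Lemma geodesicE x y : geodesic x y = [set metric_interval x y].
Proof.
apply/seteqP; split => [_ [g gxy ->]|_ ->]; first exact: geodesic_image.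
by have [g gxy] := geodY x y; exists g => //; rewrite geodesic_image.
Qed.

Lemma geodesic_segmentE x y : geodesic_segment x y = metric_interval x y.
Proof. by rewrite /geodesic_segment geodesicE; apply: xget_unique. Qed.

Lemma metric_interval_point x y s : 0 <= s <= mdist x y ->
  exists w, mdist x w = s /\ mdist w y = mdist x y - s.
Proof.
by have [g /geodesic_path_mdist gP] := geodY x y => /gP; exists (g s).
Qed.

Lemma metric_intervalC x y : metric_interval x y = metric_interval y x.
Proof.
by apply/seteqP; split=> w; rewrite /metric_interval /= ![mdist _ y]metric_sym
  ![mdist x _]metric_sym addrC.
Qed.

(* The median is the point of [x, y] at distance the Gromov product (y | z)_x
   from [x]. *)
Lemma metric_median x y z : exists w, [/\ metric_interval x y w,
  metric_interval x z w & metric_interval y z w].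
Proof.
pose s := (mdist x y + mdist x z - mdist y z) / 2.
have txyz := metric_triangle x y z; have txzy := metric_triangle x z y.
have tyxz := metric_triangle y x z.
rewrite (metric_sym z y) (metric_sym y x) in txzy tyxz.
have sI : 0 <= s <= mdist x y by apply/andP; split; rewrite /s; lra.
have [w [xw wy]] := metric_interval_point sI.
have wz : mdist w z <= mdist x z - s.
  have := fourY w z x y; rewrite (metric_sym w x) (metric_sym z x).
  by rewrite (metric_sym z y) xw wy le_max => /orP[]; rewrite /s; lra.
have := metric_triangle x w z; have := metric_triangle y w z.
rewrite (metric_sym y w) => t1 t2.
exists w; rewrite /metric_interval /= (metric_sym y w).
by split; rewrite /s in xw wy wz *; lra.
Qed.

(** The median of [x], [y], [z] lies on both segments at [y]; if these meet only in [y], it is [y],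
    so [y] lies between [x] and [z]. *)
Lemma four_point_R_tree : R_tree Y.
Proof.
split=> [x y|x y z].
  by exists (metric_interval x y); rewrite geodesicE; split=> // S ->.
rewrite !geodesic_segmentE => xyz.
have [w [wxy xz wyz]] := metric_median x y z.
have wE : w = y by rewrite -[w = y]/([set y] w) -xyz; split.
rewrite {}wE /metric_interval /= in xz => {w wxy wyz}.
have sub x' z' : mdist x' y + mdist y z' = mdist x' z' ->
    metric_interval x' y `<=` metric_interval x' z'.
  move=> e w; rewrite /metric_interval /= => xwy.
  have := metric_triangle x' w z'; have := metric_triangle w y z'; lra.
have half x' z' w : mdist x' y + mdist y z' = mdist x' z' ->
    metric_interval x' z' w -> mdist x' w <= mdist x' y ->
    metric_interval x' y w.
  move=> e wI wy; have sI : 0 <= mdist x' w <= mdist x' y by rewrite mdist_ge0.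
  have [v [v1 v2]] := metric_interval_point sI.
  have vI : metric_interval x' y v by rewrite /metric_interval /= v1 v2; lra.
  by rewrite (@metric_interval_eq x' z' w v)//; apply: sub.
have zx : mdist z y + mdist y x = mdist z x.
  by rewrite (metric_sym z y) (metric_sym y x) (metric_sym z x) addrC.
apply/seteqP; split=> [w [|wI]|w wI]; first exact: sub.
  by rewrite metric_intervalC; apply: (sub _ _ zx); rewrite metric_intervalC.
have [wy|yw] := leP (mdist x w) (mdist x y); [left|right].
  exact: half wI wy.
rewrite metric_intervalC; apply: (half _ _ _ zx); first by rewrite metric_intervalC.
move: wI; rewrite /metric_interval /= (metric_sym z w) (metric_sym z y); lra.
Qed.

End FourPoint.
Arguments four_point {R} Y.
Arguments geodesic_space {R} Y.

(** * The tree of a generalized ultrametric *)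

(* Think of [m x y] as the height at which the upward rays issued from [x] and [y]
   merge; [m x x] is the height of [x] itself and may be any real number. *)
Record gen_ultrametric (R : realType) (X : Type) := GenUltrametric {
  gumap :> X -> X -> R;
  gumapC : forall x y, gumap x y = gumap y x;
  gumap_ultra : forall y x z, gumap x z <= Num.max (gumap x y) (gumap y z)
}.

Section UltraTree.
Context {R : realType} {X : Type}.
Implicit Types (m : gen_ultrametric R X) (x y z : X) (s t : R).

Lemma gumap_diag m x y : m x x <= m x y.
Proof.
by have := gumap_ultra m y x x; rewrite (gumapC m y x) le_max => /orP[].
Qed.

Lemma gumap_base_change m x x' t y : m x x' <= t ->
  Num.max (m x y) t = Num.max (m x' y) t.
Proof.
move=> xx't; apply/eqP; rewrite eq_le !ge_max !le_max !lexx !orbT !andbT.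
apply/andP; split.
  have := gumap_ultra m x' x y; rewrite le_max => /orP[h|->//].
  by rewrite (le_trans h xx't) orbT.
have := gumap_ultra m x x' y; rewrite (gumapC m x' x) le_max => /orP[h|->//].
by rewrite (le_trans h xx't) orbT.
Qed.

Definition gu_ball m x t : set X := [set z | m x z <= t].

(* The point at height [t] above [x] is encoded by [t] and the ball of radius [t]
   around [x]. *)
Definition tree_pred m (p : R * set X) : bool :=
  `[< exists2 x, m x x <= p.1 & p.2 = gu_ball m x p.1 >].

Definition ultra_tree m : Type := {p | tree_pred m p}.

HB.instance Definition _ m := Choice.on (ultra_tree m).

Variable m : gen_ultrametric R X.
Implicit Types u v w : ultra_tree m.

Lemma tree_point_subproof x t :
  tree_pred m (Num.max t (m x x), gu_ball m x (Num.max t (m x x))).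
Proof. by apply/asboolP; exists x => //=; rewrite le_max lexx orbT. Qed.

(* A height [t < m x x] is replaced by [m x x]. *)
Definition tree_point x t : ultra_tree m := Sub _ (tree_point_subproof x t).

Definition tree_height u : R := (val u).1.

Lemma tree_pointP u : exists x, m x x <= tree_height u /\
  u = tree_point x (tree_height u).
Proof.
have /asboolP[x xx xE] := valP u; exists x; split => //.
apply: val_inj; rewrite /= (max_idPl xx) -xE; exact: surjective_pairing.
Qed.

Definition tree_base u : X := projT1 (cid (tree_pointP u)).

Lemma tree_base_height u : m (tree_base u) (tree_base u) <= tree_height u.
Proof. by rewrite /tree_base; case: cid => x []. Qed.

Lemma tree_baseK u : tree_point (tree_base u) (tree_height u) = u.
Proof. by rewrite /tree_base; case: cid => x []. Qed.

Lemma tree_height_point x t : m x x <= t -> tree_height (tree_point x t) = t.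
Proof. by move=> xt; apply/max_idPl. Qed.

Lemma eq_tree_point x y t : m x y <= t -> tree_point x t = tree_point y t.
Proof.
move=> xyt; have xt := le_trans (gumap_diag m x y) xyt.
have yt : m y y <= t by apply: le_trans xyt; rewrite gumapC gumap_diag.
apply: val_inj; rewrite /= (max_idPl xt) (max_idPl yt); congr (_, _).
apply/seteqP; split=> z /= h.
  by apply: (le_trans (gumap_ultra m x y z)); rewrite ge_max gumapC xyt.
by apply: (le_trans (gumap_ultra m y x z)); rewrite ge_max xyt.
Qed.

Lemma gumap_tree_base x t : m x x <= t -> m (tree_base (tree_point x t)) x <= t.
Proof.
move=> xt; have := tree_baseK (tree_point x t).
set y := tree_base _; rewrite tree_height_point// => yE.
have : (val (tree_point y t)).2 x by rewrite yE /= (max_idPl xt).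
rewrite /= /gu_ball /= (max_idPl _) //.
by rewrite -[leRHS](tree_height_point xt) tree_base_height.
Qed.

Definition tree_join u v : R :=
  Num.max (m (tree_base u) (tree_base v))
    (Num.max (tree_height u) (tree_height v)).

Lemma tree_join_point x y t s : m x x <= t -> m y y <= s ->
  tree_join (tree_point x t) (tree_point y s) =
    Num.max (m x y) (Num.max t s).
Proof.
move=> xt ys; rewrite /tree_join !tree_height_point//.
have := gumap_tree_base xt; have := gumap_tree_base ys.
move=> y'y x'x; rewrite (gumap_base_change (x' := x)) ?le_max ?x'x //.
by rewrite gumapC (gumap_base_change (x' := y)) ?le_max ?y'y ?orbT // gumapC.
Qed.

(** Length of the path that climbs from [u] to the join and descends to [v]. *)
Definition tree_dist u v : R :=
  2 * tree_join u v - tree_height u - tree_height v.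

Lemma tree_dist_point x y t s : m x x <= t -> m y y <= s ->
  tree_dist (tree_point x t) (tree_point y s) =
    2 * Num.max (m x y) (Num.max t s) - t - s.
Proof.
by move=> xt ys; rewrite /tree_dist tree_join_point// !tree_height_point.
Qed.

Lemma tree_joinC u v : tree_join u v = tree_join v u.
Proof. by rewrite /tree_join gumapC maxC (maxC (tree_height u)) maxC. Qed.

Lemma tree_join_ultra v u w :
  tree_join u w <= Num.max (tree_join u v) (tree_join v w).
Proof.
have := gumap_ultra m (tree_base v) (tree_base u) (tree_base w).
rewrite /tree_join !ge_max !le_max !lexx !orbT !andbT.
by case/orP=> ->; rewrite ?orbT.
Qed.

Lemma tree_join_ge u v : tree_height u <= tree_join u v.
Proof. by rewrite /tree_join !le_max lexx !orbT. Qed.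

Lemma tree_joinxx u : tree_join u u = tree_height u.
Proof. by rewrite /tree_join maxxx (max_idPr (tree_base_height u)). Qed.

Lemma tree_distxx u : tree_dist u u = 0.
Proof. by rewrite /tree_dist tree_joinxx; lra. Qed.

Lemma tree_distC u v : tree_dist u v = tree_dist v u.
Proof. by rewrite /tree_dist tree_joinC; lra. Qed.

Lemma tree_dist0 u v : tree_dist u v = 0 -> u = v.
Proof.
rewrite /tree_dist => uv0; have := tree_join_ge u v; have := tree_join_ge v u.
rewrite (tree_joinC v u) => vh uh.
have hE : tree_height u = tree_height v by lra.
rewrite -(tree_baseK u) -(tree_baseK v) hE; apply: eq_tree_point.
have -> : tree_height v = tree_join u v by lra.
by rewrite /tree_join le_max lexx.
Qed.

Lemma tree_dist_triangle v u w : tree_dist u w <= tree_dist u v + tree_dist v w.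
Proof.
rewrite /tree_dist; have := tree_join_ge v u; have := tree_join_ge v w.
rewrite (tree_joinC v u).
by have := tree_join_ultra v u w; rewrite le_max => /orP[]; lra.
Qed.

HB.instance Definition _ := isMetric.Build R (ultra_tree m)
  tree_distxx tree_dist0 tree_distC tree_dist_triangle.

Lemma tree_mdistE u v : mdist u v = tree_dist u v.
Proof. by []. Qed.

(** All three sums contain the same heights, which cancel. What remains follows from the ultrametric
    inequality for joins, used for [x, y] and for [z, w] through each of the other two points. *)
Lemma ultra_tree_four_point : four_point (ultra_tree m).
Proof.
move=> x y z w; rewrite !tree_mdistE /tree_dist leNgt gt_max.
have j u v a := tree_join_ultra v u a.
move: (j x z y) (j x w y) (j z x w) (j z y w).
rewrite (tree_joinC z x) !(tree_joinC z y) (tree_joinC w y).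
move: (tree_join x y) (tree_join z w) (tree_join x z) (tree_join y w)
  (tree_join x w) (tree_join y z) => xy zw xz yw xw yz.
rewrite !le_max; have [?|?] := leP xy zw; do 4 (case/orP => ?);
  by apply/negP => /andP[? ?]; lra.
Qed.

Lemma tree_mdist_point x y t s : m x x <= t -> m y y <= s ->
  mdist (tree_point x t) (tree_point y s) =
    2 * Num.max (m x y) (Num.max t s) - t - s.
Proof. exact: tree_dist_point. Qed.

Lemma tree_mdist_above x t s : m x x <= t -> m x x <= s ->
  mdist (tree_point x t) (tree_point x s) = `|t - s|.
Proof.
move=> xt xs; rewrite tree_mdist_point// (max_idPr _) ?le_max ?xt//.
have [ts|st] := leP t s; first by rewrite ler0_norm; lra.
by rewrite ger0_norm; lra.
Qed.

Lemma ultra_tree_geodesic : geodesic_space (ultra_tree m).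
Proof.
move=> u v; have [x [xt ->]] := tree_pointP u; have [y [ys ->]] := tree_pointP v.
set t := tree_height u in xt *; set s := tree_height v in ys *.
rewrite /geodesic_path tree_mdist_point//.
set M := Num.max _ _; set d := 2 * M - t - s.
have [xyM tM sM] : [/\ m x y <= M, t <= M & s <= M].
  by rewrite /M !le_max !lexx !orbT.
have ME : [\/ M = m x y, M = t | M = s].
  rewrite /M; case: (leP t s) => _.
    by case: (leP (m x y) s) => _; [exact: Or33|exact: Or31].
  by case: (leP (m x y) t) => _; [exact: Or32|exact: Or31].
(* The join stays at height [M]: if [M] is [t] or [s] rather than [m x y], then [a] or [b] is
   already [M]. *)
have mixed a b : t <= a -> a <= M -> s <= b -> b <= M ->
    mdist (tree_point x a) (tree_point y b) = 2 * M - a - b.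
  move=> ta aM sb bM; rewrite tree_mdist_point ?(le_trans xt) ?(le_trans ys)//.
  suff -> : Num.max (m x y) (Num.max a b) = M by [].
  clearbody M.
  apply/eqP; rewrite eq_le !ge_max xyM aM bM /= !le_max.
  by case: ME => ->; rewrite ?lexx ?ta ?sb ?orbT.
exists (fun r => if r <= M - t then tree_point x (t + r)
  else tree_point y (s + d - r)); split.
- by rewrite subr_ge0 tM addr0.
- rewrite addrK; case: ifPn => // dM; rewrite (@eq_tree_point x y).
    by congr tree_point; rewrite /d in dM *; lra.
  by rewrite /d in dM *; lra.
- move=> r r'; rewrite !in_itv /= => /andP[r0 rd] /andP[r'0 r'd].
  case: ifPn; rewrite -?ltNge => rM; case: ifPn; rewrite -?ltNge => r'M.
  + rewrite tree_mdist_above; try lra.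
    by congr (`|_|); lra.
  + rewrite mixed; try (rewrite /d in rd r'd *; lra).
    by rewrite ler0_norm /d; lra.
  + rewrite metric_sym mixed; try (rewrite /d in rd r'd *; lra).
    by rewrite ger0_norm /d; lra.
  + rewrite tree_mdist_above; try (rewrite /d in rd r'd *; lra).
    by rewrite distrC; congr (`|_|); lra.
Qed.

Lemma ultra_tree_R_tree : R_tree (ultra_tree m).
Proof. exact: (four_point_R_tree ultra_tree_four_point ultra_tree_geodesic). Qed.

Definition tree_leaf x : ultra_tree m := tree_point x (m x x).

Lemma tree_leaf_mdist x y :
  mdist (tree_leaf x) (tree_leaf y) = 2 * m x y - m x x - m y y.
Proof.
rewrite tree_mdist_point//; congr (2 * _ - _ - _); apply/max_idPl.
by rewrite ge_max gumap_diag gumapC gumap_diag.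
Qed.

(* Two upward rays always merge at a leaf. *)
Hypothesis branch_leaf : forall x y, exists z, m x z <= m x y /\ m z z = m x y.

(** A path from [u] can leave the ray over [tree_base u] only where another ray merges with it or at
    its bottom. Both are leaves, hence at distance at least [e]. *)
Lemma tree_ball_off_leaves u v e : (forall z, e <= mdist u (tree_leaf z)) ->
  mdist u v < e -> m (tree_base u) (tree_base u) <= tree_height v /\
    v = tree_point (tree_base u) (tree_height v).
Proof.
rewrite -{1 2}(tree_baseK u); have := tree_base_height u.
set x := tree_base u; set t := tree_height u => xt ue.
have [y [ys ->]] := tree_pointP v; rewrite tree_height_point//.
set s := tree_height v in ys *; rewrite tree_mdist_point// => uv.
have [z [xz zz]] := branch_leaf x y.
have := ue x; have := ue z; rewrite !tree_mdist_point// zz.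
rewrite (max_idPr (_ : m x z <= _)) ?le_max ?xz ?orbT//.
rewrite (max_idPr (_ : m x x <= Num.max t _)) ?le_max ?xt// (max_idPl xt) => q xe.
have [h1 [h2 h3]] : 2 * m x y - t - s < e /\ t - s < e /\ s - t < e.
  have : 2 * Num.max (m x y) (Num.max t s) < e + t + s by lra.
  have : m x y <= Num.max (m x y) (Num.max t s) by rewrite le_max lexx.
  have : t <= Num.max (m x y) (Num.max t s) by rewrite !le_max lexx orbT.
  have : s <= Num.max (m x y) (Num.max t s) by rewrite !le_max lexx !orbT.
  by lra.
split; first by lra.
apply/esym/eq_tree_point; move: q; case: (leP t (m x y)); lra.
Qed.

Lemma regular_off_leaves u e : 0 < e ->
  (forall z, e <= mdist u (tree_leaf z)) -> regular_point u.
Proof.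
move=> e0 ue; exists e => //; exists tree_height => v w.
rewrite !ballEmdist /= => /(tree_ball_off_leaves ue)[xv vE].
move=> /(tree_ball_off_leaves ue)[xw wE].
by rewrite {2}vE {2}wE tree_mdist_above.
Qed.

End UltraTree.

(** * Completeness and singular points *)

Section CompleteRange.
Context {R : realType} {X Y : metricType R}.

(** [F] is pulled back to the filter [G] of points whose images come close to members of [F]. The
    lower bilipschitz bound makes [G] Cauchy, and the upper one carries its limit over to [F]. *)
Lemma cauchy_near_range (C : R) (f : X -> Y) (F : set_system Y) :
  complete_space X -> bilipschitz C f -> ProperFilter F -> cauchy F ->
  (forall e, 0 < e -> ~ F [set u | forall z, e <= mdist u (f z)]) ->
  exists x, F --> f x.
Proof.
move=> cX [C0 [s s0 fs]] FF /cauchyP Fc Fnear.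
have near P e : F P -> 0 < e -> exists v z, P v /\ mdist v (f z) < e.
  move=> FP e0; apply: contrapT => PN; apply: (Fnear _ e0).
  apply: filterS FP => v Pv z; rewrite leNgt; apply/negP => vz.
  by apply: PN; exists v, z.
pose G : set_system X := [set A | exists e P, [/\ 0 < e, F P
  & forall v z, P v -> mdist v (f z) < e -> A z]].
have FG : ProperFilter G.
  split; first by move=> [e [P [e0 FP]]] PA; have [v [z [Pv vz]]] := near P e FP e0;
    exact: PA Pv vz.
  split.
  - by exists 1, setT; split => //; exact: filterT.
  - move=> A B [e [P [e0 FP PA]]] [e' [P' [e'0 FP' PB]]].
    exists (Num.min e e'), (P `&` P'); rewrite lt_min e0 e'0.
    split=> //; first exact: filterI.
    by move=> v z [Pv P'v]; rewrite lt_min => /andP[h h']; split;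
      [apply: PA h|apply: PB h'].
  - move=> A B AB [e [P [e0 FP PA]]]; exists e, P; split => // v z Pv h.
    by apply: AB; apply: PA h.
have Gnear u e : 0 < e -> F (ball u e) ->
    G [set z | exists v, mdist u v < e /\ mdist v (f z) < e].
  move=> e0 Fe; exists e, (ball u e); split => // v z.
  by rewrite ballEmdist => uv vz; exists v.
have [x Gx] : exists x : X, G --> x.
  (* The images of [z0] and [z] are both within [2 * d] of [u], hence less than [4 * d = s * e]
     apart. *)
  apply: (cX G FG); apply/cauchyP => e e0; pose d := s * e / 4.
  have d0 : 0 < d by rewrite /d divr_gt0 ?mulr_gt0.
  have [u Fu] := Fc d d0; have Gu := Gnear u d d0 Fu.
  have [z0 [v0 [uv0 vz0]]] := filter_ex Gu.
  exists z0; apply: filterS Gu => z [v [uv vz]]; rewrite ballEmdist /=.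
  rewrite -(ltr_pM2l s0); have /andP[h _] := fs z0 z; apply: (le_lt_trans h).
  have := metric_triangle (f z0) v0 (f z); have := metric_triangle v0 u (f z).
  have := metric_triangle u v (f z); rewrite (metric_sym (f z0) v0) (metric_sym v0 u).
  by rewrite /d in uv0 vz0 uv vz; lra.
exists x; apply/fcvg_ballP => e e0; pose d := e / 4.
have d0 : 0 < d by rewrite /d divr_gt0.
have [u Fu] := Fc d d0.
(* Adding 1 allows division even if [C = 0]. *)
have Cs1 : 0 < C * s + 1 by rewrite ltr_wpDl // mulr_ge0 // ltW.
have Gb : G (ball x (d / (C * s + 1))).
  by apply: Gx; apply/nbhs_ballP; exists (d / (C * s + 1)) => //=; rewrite divr_gt0.
have [z [xz [v [uv vz]]]] := filter_ex (filterI Gb (Gnear u d d0 Fu)).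
have {}xz : mdist (f x) (f z) < d.
  have /andP[_ h] := fs x z; apply: (le_lt_trans h).
  move: xz; rewrite ballEmdist /= ltr_pdivlMr //.
  by have := mdist_ge0 x z; lra.
rewrite near_simpl; apply: filterS Fu => w; rewrite !ballEmdist /= => uw.
have := metric_triangle (f x) (f z) w; have := metric_triangle (f z) v w.
have := metric_triangle v u w; rewrite (metric_sym v u) (metric_sym (f z) v).
by rewrite /d in xz uv vz uw; lra.
Qed.

(** Otherwise the neighbourhood filter of [u] would converge to a point of the range, which is [u]
    by uniqueness of limits. *)
Lemma bilipschitz_range_sep (C : R) (f : X -> Y) (u : Y) :
  complete_space X -> bilipschitz C f -> ~ range f u ->
  exists2 e, 0 < e & forall z, e <= mdist u (f z).
Proof.
move=> cX fC fu; apply: contrapT => Ne; apply: fu.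
have [||x ux] := @cauchy_near_range C f (nbhs u) cX fC _.
- by apply/cauchyP => e e0; exists u; exact: nbhsx_ballx.
- by move=> e e0 /nbhs_singleton ue; apply: Ne; exists e.
- exists x => //; apply: esym; apply: (@metric_hausdorff _ Y).
  by move=> A B uA /ux xB; exact: filter_ex (filterI uA xB).
Qed.

End CompleteRange.

Section CompleteTree.
Context {R : realType} {X : metricType R} (m : gen_ultrametric R X) (C : R).
Hypothesis X_complete : complete_space X.
Hypothesis leaf_bilip : bilipschitz C (@tree_leaf R X m).
Hypothesis branch_leaf : forall x y, exists z, m x z <= m x y /\ m z z = m x y.

Lemma tree_height_mdist (u v : ultra_tree m) :
  `|tree_height u - tree_height v| <= mdist u v.
Proof.
rewrite tree_mdistE /tree_dist ler_norml.
have := tree_join_ge u v; have := tree_join_ge v u; rewrite (tree_joinC v u) => h h'.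
by apply/andP; split; lra.
Qed.

(** A Cauchy filter that stays away from the leaves eventually lies on a single ray, where
    convergence is that of the heights; otherwise it converges to a leaf. *)
Lemma ultra_tree_complete : complete_space (ultra_tree m).
Proof.
move=> F FF Fc; move: (Fc) => /cauchyP Fex.
have [[e [e0 Fe]]|Fn] := pselect (exists e, 0 < e /\
    F [set u | forall z, e <= mdist u (@tree_leaf R X m z)]); last first.
  have [e e0 Fe|x Fx] := cauchy_near_range X_complete leaf_bilip FF Fc.
    by apply: Fn; exists e.
  by exists (tree_leaf m x).
have e20 : 0 < e / 2 by rewrite divr_gt0.
have [u0 Fu0] := Fex _ e20.
have [u [ue u0u]] := filter_ex (filterI Fe Fu0).
pose x := tree_base u.
have Fx : F [set v | m x x <= tree_height v /\ v = tree_point m x (tree_height v)].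
  apply: filterS Fu0 => v u0v; apply: (tree_ball_off_leaves branch_leaf ue).
  rewrite !ballEmdist /= in u0u u0v.
  by have := metric_triangle u u0 v; rewrite (metric_sym u u0); lra.
have /R_complete/cvg_ex[l hl] : cauchy (@tree_height R X m @ F).
  apply/cauchyP => d d0; have [w Fw] := Fex _ d0.
  exists (tree_height w).
  suff: F [set v | ball (tree_height w) d (tree_height v)] by [].
  apply: filterS Fw => v; rewrite ballEmdist /= => wv.
  exact: le_lt_trans (tree_height_mdist w v) wv.
exists (tree_point m x l); apply/fcvg_ballP => d d0.
move/cvgrPdist_lt/(_ d d0) : hl => hl; rewrite near_simpl.
have {}hl : F [set v | `|l - tree_height v| < d] by [].
apply: filterS (filterI Fx hl) => v [[xv vE] lv]; rewrite ballEmdist /= vE.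
have -> : tree_point m x l = tree_point m x (Num.max l (m x x)).
  by apply: val_inj; rewrite /= -maxA maxxx.
rewrite tree_mdist_above ?le_max ?lexx ?orbT //.
apply: le_lt_trans lv; case: (leP l (m x x)) => // lx.
by rewrite !ler0_norm; lra.
Qed.

Lemma sing_ultra_tree : sing (ultra_tree m) `<=` range (@tree_leaf R X m).
Proof.
move=> u us; apply: contrapT => /(bilipschitz_range_sep X_complete leaf_bilip)[e e0 ue].
exact/us/(regular_off_leaves branch_leaf e0 ue).
Qed.

End CompleteTree.

(** * The generalized ultrametric of a nested family of partitions *)

Section NestedPartitions.
Context {R : realType} {X : choiceType} (E : int -> X -> X -> Prop).
Hypotheses (E_refl : forall n x, E n x x)
  (E_sym : forall n x y, E n x y -> E n y x)
  (E_trans : forall n x y z, E n x y -> E n y z -> E n x z)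
  (E_mono : forall n n' x y, n <= n' -> E n x y -> E n' x y)
  (E_join : forall x y, exists n, E n x y).
Implicit Types (n k : int) (x y z : X).

(* Taking least elements for one well-order of [X] makes the representatives
   compatible across all levels at once, and eventually constant. *)
Lemma nested_representatives : exists p : int -> X -> X,
  [/\ forall n x, E n x (p n x),
      forall n x y, E n x y -> p n x = p n y,
      forall n k x, n <= k -> p n (p k x) = p k x
    & forall x, exists k, forall n, k <= n -> p n x = p (n + 1) x].
Proof.
have [le wo] := well_ordering_principle X.
pose cls n x : {pred X} := fun y => `[< E n x y >].
have /choice[p pP] : forall nx : int * X, exists z, minimum_of le (cls nx.1 nx.2) z.
  move=> [n x]; have [|z [zm _]] := wo (cls n x); last by exists z.
  by exists x; apply/asboolP.
have min_uniq (A : {pred X}) z z' : minimum_of le A z -> minimum_of le A z' -> z = z'.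
  move=> zm zm'; have [|w [_ wu]] := wo A; first by exists z; case: zm.
  by rewrite -(wu z zm) -(wu z' zm').
have Ep n x : E n x (p (n, x)) by have [/asboolP] := pP (n, x).
have pmin n x y : E n x y -> le (p (n, x)) y.
  by move=> nxy; have [_] := pP (n, x); apply; apply/asboolP.
have p_eq n x z : E n x z -> (forall y, E n x y -> le z y) -> p (n, x) = z.
  move=> xz zmin; apply: (min_uniq (cls n x)); first exact: pP.
  by split=> [|y /asboolP]; [apply/asboolP|apply: zmin].
exists (fun n x => p (n, x)); split => //.
- move=> n x y xy; apply: p_eq; first exact: E_trans xy (Ep n y).
  by move=> z xz; apply: pmin; apply: E_trans xz; exact: E_sym.
- move=> n k x nk; apply: p_eq => // y /(E_mono nk) xy.
  by apply: pmin; apply: E_trans xy.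
(* The least element [r] of [X] represents every class that contains it. *)
- move=> x; have [|r [[_ rmin] _]] := wo predT; first by exists x.
  have [k xr] := E_join x r; exists k => n kn.
  by transitivity r; [|apply/esym]; apply: p_eq => [|y _];
    try exact: rmin; apply: E_mono xr => //; lia.
Qed.

(* [D n x] is the depth below the root of the representative of the level [n]
   class of [x]; passing from level [n + 1] to level [n] costs an edge of length
   [2 ^ (n + 1)] unless the representative stays the same. *)
Lemma level_depth (p : int -> X -> X) :
    (forall n x y, E n x y -> p n x = p n y) ->
    (forall x, exists k, forall n, k <= n -> p n x = p (n + 1) x) ->
  exists D : int -> X -> R,
    (forall n x, D n x = (if p n x == p (n + 1) x then 0 else 2 ^ (n + 1)) +
                         D (n + 1) x) /\
    (forall n x y, E n x y -> D n x = D n y).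
Proof.
move=> pE pcst; pose F x n : R := if p n x == p (n + 1) x then 0 else 2 ^ (n + 1).
pose S n x (k : nat) : R := \sum_(i < k) F x (n + i%:Z).
exists (fun n x => limn (S n x)); split; last first.
  move=> n x y xy; congr (limn _); apply: funext => k; apply: eq_bigr => i _.
  by rewrite /F !(pE _ x y)//; apply: E_mono xy; lia.
(* The partial sums stop changing once the representatives do. *)
have limS n x : exists K : nat, forall k : nat, (K <= k)%N -> limn (S n x) = S n x k.
  have [k0 k0P] := pcst x; pose K := `|k0 - n|%N.
  have SK (k : nat) : (K <= k)%N -> S n x k = S n x K.
    move=> /subnK <-; elim: (k - K)%N => [//|j IH].
    rewrite addSn -IH /S big_ord_recr /= /F k0P ?eqxx ?addr0//.
    by rewrite /K; lia.
  exists K => k Kk; rewrite (SK k Kk); apply: lim_near_cst => //.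
  by exists K => // j /= Kj; rewrite SK.
move=> n x; have [K1 K1P] := limS n x; have [K2 K2P] := limS (n + 1) x.
rewrite (K1P (maxn K1 K2).+1) ?(leqW (leq_maxl _ _))//.
rewrite (K2P (maxn K1 K2)) ?leq_maxr// /S big_ord_recl /= addr0; congr (_ + _).
by apply: eq_bigr => i _; congr F; rewrite /bump /=; lia.
Qed.

Hypothesis E_sep : forall x y, x <> y -> exists n, ~ E n x y.

Lemma splitting_level x y : x <> y -> exists n, E n x y /\ ~ E (n - 1) x y.
Proof.
move=> /E_sep[k kN]; have [n nE] := E_join x y.
have ex : exists j : nat, `[< E (k + j%:Z) x y >].
  by exists `|n - k|%N; apply/asboolP; apply: E_mono nE; lia.
case: (ex_minnP ex) => -[|j] /asboolP jE jmin; first by rewrite addr0 in jE.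
exists (k + j.+1%:Z); split=> // /asboolP.
have -> : k + j.+1%:Z - 1 = k + j%:Z by lia.
by move=> /jmin; rewrite ltnn.
Qed.

(* The height of a point is minus its depth, so [- m x y] is the depth of the
   representative of the smallest class containing both [x] and [y]; for [x = y]
   it is the limit of the depths of the representatives shrinking to [x]. *)
Lemma nested_gen_ultrametric : exists m : gen_ultrametric R X,
  (forall x y, exists z, m x z <= m x y /\ m z z = m x y) /\
  (forall x y n, E n x y -> ~ E (n - 1) x y ->
    2 ^ n <= 2 * m x y - m x x - m y y <= 2 ^ (n + 2)).
Proof.
have [p [Ep p_eq p_nest p_cst]] := nested_representatives.
have [D [D_rec D_eq]] := level_depth p_eq p_cst.
have pow_gt0 n : 0 < 2 ^ n :> R by rewrite exprz_gt0.
have powS n : 2 ^ (n + 1) = 2 * 2 ^ n :> R by rewrite expfzDr// mulrC.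
(* The second bound makes [D n x + 2 ^ (n + 1)] nondecreasing in [n]; telescoped, it sums the
   geometric series of edge lengths. *)
have D_step n x : D (n + 1) x <= D n x /\
    D n x + 2 ^ (n + 1) <= D (n + 1) x + 2 ^ (n + 1 + 1).
  rewrite (D_rec n x) (powS (n + 1)); have := pow_gt0 (n + 1).
  by case: ifP => _; lra.
have D_mono n n' x : n <= n' -> D n' x <= D n x /\
    D n x + 2 ^ (n + 1) <= D n' x + 2 ^ (n' + 1).
  move=> nn'; have -> : n' = n + `|n' - n|%N%:Z by lia.
  elim: `|n' - n|%N => [|j [IH1 IH2]]; first by rewrite addr0.
  have -> : n + j.+1%:Z = n + j%:Z + 1 by lia.
  by have [h1 h2] := D_step (n + j%:Z) x; split; [exact: le_trans IH1|exact: le_trans h2].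
have D_le n n' x : D n x <= D n' x + 2 ^ (n' + 1).
  have [nn'|n'n] := leP n n'.
    by have [_] := D_mono n n' x nn'; have := pow_gt0 (n + 1); lra.
  by have [] := D_mono n' n x (ltW n'n); have := pow_gt0 (n' + 1); lra.
pose A x y : R := sup [set D n x | n in [set n | E n x y]].
have A_ge x y n : E n x y -> D n x <= A x y.
  move=> nxy; apply: ub_le_sup; last by exists n.
  by exists (D 0 x + 2 ^ (0 + 1)) => _ [k _ <-].
have A_le x y b : (forall n, E n x y -> D n x <= b) -> A x y <= b.
  move=> h; apply: sup_le_ub => [|_ [n nxy <-]]; last exact: h.
  by have [n nxy] := E_join x y; exists (D n x), n.
have A_half x y : A x y <= A y x.
  by apply: A_le => n xy; rewrite (D_eq n x y)//; apply/A_ge/E_sym.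
have A_C x y : A x y = A y x by apply/eqP; rewrite eq_le !A_half.
(* If some level joins [x, y] but not [y, z], then every level joining [y, z] is higher and joins
   [x, y] too. *)
have A_ultra y x z : A x y <= A x z \/ A y z <= A x z.
  have [sub|/existsNP[n /not_implyP[nxy nyz]]] :=
    pselect (forall n, E n x y -> E n y z); [left|right].
    by apply: A_le => n xy; apply: A_ge; apply: E_trans (sub n xy).
  apply: A_le => k yz; have xy : E k x y.
    by apply: E_mono nxy; rewrite leNgt; apply/negP => /ltW kn; exact/nyz/(E_mono kn).
  by rewrite -(D_eq k x y)//; apply: A_ge; apply: E_trans yz.
have A_split x y n : E n x y -> ~ E (n - 1) x y -> A x y = D n x.
  move=> xy nxy; apply/eqP; rewrite eq_le A_ge// andbT; apply: A_le => k kxy.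
  have nk : n <= k.
    by rewrite leNgt; apply/negP => kn; apply: nxy; apply: E_mono kxy; lia.
  by have [] := D_mono n k x nk.
have mC x y : - A x y = - A y x by rewrite A_C.
have m_ultra y x z : - A x z <= Num.max (- A x y) (- A y z).
  by rewrite le_max !lerN2; apply/orP; exact: A_ultra.
exists (GenUltrametric mC m_ultra); split => [x y|x y n xy nxy] /=.
  have [->|/splitting_level[n [xy nxy]]] := pselect (x = y); first by exists y.
  (* [z] remains its own representative at all levels below [n], so its depth no longer grows
     there. *)
  have xz := Ep n x; set z := p n x in xz *; exists z.
  rewrite (A_split x y n)// lerN2 A_ge//; split=> //; congr (- _).
  have zle k : k <= n -> p k z = z by move=> kn; rewrite p_nest.
  rewrite (D_eq n x z)//; apply/eqP; rewrite eq_le A_ge// andbT.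
  apply: A_le => k _; have [nk|kn] := leP n k; first by have [] := D_mono n k z nk.
  have -> : k = n - `|n - k|%N%:Z by lia.
  elim: `|n - k|%N => [|j IH]; first by rewrite subr0.
  rewrite D_rec; have -> : n - j.+1%:Z + 1 = n - j%:Z by lia.
  by rewrite !zle ?eqxx ?add0r//; lia.
have Axx_le u : A u u <= D n u + 2 ^ (n + 1) by exact: A_le.
have Axx_ge u : D (n - 1) u <= A u u by exact: A_ge.
have pow2 : 2 ^ (n + 2) = 4 * 2 ^ n :> R.
  by rewrite (_ : n + 2 = n + 1 + 1) ?powS; [lra|lia].
(* Hence at least one of the two descents from level [n] uses an edge of length [2 ^ n]: the lower
   bound. Each descent costs at most [2 ^ (n + 1)]: the upper bound. *)
have neq : ~ (p (n - 1) x = p n x /\ p (n - 1) y = p n y).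
  move=> [ex ey]; apply: nxy; apply: E_trans (Ep _ _) _.
  by rewrite ex (p_eq _ _ _ xy) -ey; exact/E_sym/Ep.
have := D_rec (n - 1) x; have := D_rec (n - 1) y; rewrite subrK.
have := Axx_le x; have := Axx_le y; have := Axx_ge x; have := Axx_ge y.
rewrite (A_split x y n)// -(D_eq n x y xy) pow2 powS; have := pow_gt0 n.
case: eqP => [ey|_]; case: eqP => [ex|_]; first by case: neq.
all: by move=> *; apply/andP; split; lra.
Qed.

End NestedPartitions.

(** * Chains in a space of Nagata dimension zero *)

Section Linked.
Context {R : realType} {X : metricType R}.
Implicit Types (s : R) (x y z : X).

(* No set closed under steps of length at most [s] separates [y] from [x]:
   [x] and [y] are joined by a finite chain of such steps. *)
Definition linked s x y : Prop := forall A : set X,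
  (forall a b, A a -> mdist a b <= s -> A b) -> A x -> A y.

Lemma linked_sym s x y : linked s x y -> linked s y x.
Proof.
move=> xy A As Ay; apply: contrapT => nAx; apply: (xy (~` A)) => // a b nAa ab Ab.
by apply: nAa; apply: (As _ _ Ab); rewrite metric_sym.
Qed.

Lemma linked_trans s x y z : linked s x y -> linked s y z -> linked s x z.
Proof. by move=> xy yz A As Ax; apply: (yz _ As); apply: xy. Qed.

Lemma linked_mono s s' x y : s <= s' -> linked s x y -> linked s' x y.
Proof.
move=> ss' xy A As'; apply: xy => a b Aa ab; apply: (As' _ _ Aa).
exact: le_trans ss'.
Qed.

Lemma linked_mdist s x y : mdist x y <= s -> linked s x y.
Proof. by move=> xy A As Ax; exact: As Ax xy. Qed.

(** Distinct members of the covering are more than [s] apart, so a chain of steps of length at most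
    [s] never leaves the member it starts in. *)
Lemma nagata_linked c s x y : nagata_dim_zero X c -> 0 < s ->
  linked s x y -> mdist x y <= c * s.
Proof.
move=> Xc s0 xy; have [Bs [cov Bdiam Bsep]] := Xc s s0.
have [B BB Bx] : (\bigcup_(B in Bs) B) x by rewrite cov.
have By : B y.
  apply: xy Bx => a b Ba ab; have [B' BB' Bb] : (\bigcup_(B in Bs) B) b by rewrite cov.
  suff -> : B = B' by [].
  apply: contrapT => /(Bsep _ _ BB BB'); rewrite ltNge => /negP; apply.
  apply: (@le_trans _ _ (mdist a b)%:E); last by rewrite lee_fin.
  by apply: ereal_inf_lbound; exists a => //; exists b.
rewrite -lee_fin; apply: le_trans (Bdiam B BB).
by apply: ereal_sup_ubound; exists x => //; exists y.
Qed.

End Linked.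

Theorem corollary1p3 (R : realType) (X : metricType R) (c : R)
    (c_ge0 : 0 <= c) (X_complete : complete_space X)
    (X_nagata : nagata_dim_zero X c) :
  exists (Y : metricType R) (f : X -> Y),
    [/\ complete_space Y, R_tree Y, bilipschitz (8 * c) f
      & sing Y `<=` range f].
Proof.
pose E (n : int) (x y : X) := linked (2 ^ n) x y.
have pow_gt0 n : 0 < 2 ^ n :> R by rewrite exprz_gt0.
have E_dist n x y : E n x y -> mdist x y <= c * 2 ^ n by exact: nagata_linked.
have E_mono (n n' : int) x y : n <= n' -> E n x y -> E n' x y.
  by move=> nn'; apply: linked_mono; rewrite ler_eXz2l ?ltr1n.
have pow_unbounded (r : R) : exists k : nat, r < 2 ^ k%:Z.
  by exists (Num.bound r); apply: upper_nthrootP.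
have E_join x y : exists n, E n x y.
  have [k /ltW xy] := pow_unbounded (mdist x y); exists k%:Z.
  exact: linked_mdist.
have E_sep x y : x <> y -> exists n, ~ E n x y.
  move=> /eqP; rewrite -mdist_gt0 => xy; apply/existsNP => xyE.
  have [k] := pow_unbounded (c / mdist x y); rewrite ltNge => /negP; apply.
  rewrite ler_pdivlMr // mulrC -ler_pdivlMr //.
  by have := E_dist _ _ _ (xyE (- k%:Z)); rewrite -exprnN.
have [|||m [m_branch m_dist]] := nested_gen_ultrametric (R := R) _ _ _ E_mono E_join E_sep.
- by move=> n x A.
- by move=> n x y; exact: linked_sym.
- by move=> n x y z; exact: linked_trans.
have leaf_bilip : bilipschitz (8 * c) (@tree_leaf R X m).
  split; first by rewrite mulr_ge0.
  (* The factor [c^-1] compensates for [mdist x y <= c * 2 ^ n]. If [c = 0], then [X] has at most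
     one point and any positive factor works. *)
  exists (if c == 0 then 1 else c^-1).
    by case: eqVneq => // c0; rewrite invr_gt0 lt_def c0.
  move=> x y; rewrite tree_leaf_mdist.
  have [->|/[dup] xy] := pselect (x = y); first by rewrite mdistxx; apply/andP; split; lra.
  move=> /(splitting_level E_mono E_join E_sep)[n [nE nNE]].
  have /andP[lo hi] := m_dist x y n nE nNE.
  have cd := E_dist n x y nE.
  have c0 : 0 < c.
    rewrite lt_def c_ge0 andbT; apply/eqP => c0; apply: xy; apply: mdist_positivity.
    by apply/eqP; rewrite eq_le mdist_ge0 andbT; rewrite c0 mul0r in cd.
  rewrite gt_eqF// mulfK ?gt_eqF//; apply/andP; split.
    by apply: le_trans lo; rewrite mulrC ler_pdivrMr // mulrC.
  (* Points not linked at level [n - 1] are more than [2 ^ (n - 1)] apart, and [2 ^ (n + 2)] is 8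
     times that. *)
  apply: (le_trans hi); have -> : n + 2 = (n - 1) + 3 by lia.
  rewrite expfzDr// mulrC (_ : 2 ^ 3 = 8)//; last by rewrite -[LHS]/(2 ^+ 3) -natrX.
  rewrite ler_pM2l //; rewrite leNgt; apply/negP => /ltW d; apply: nNE.
  exact: linked_mdist.
exists (ultra_tree m), (tree_leaf m); split => //.
- exact: ultra_tree_complete leaf_bilip m_branch.
- exact: ultra_tree_R_tree.
- exact: sing_ultra_tree leaf_bilip m_branch.
Qed.
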